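(* Let $r>\frac12$ and for $s>0$ let $y(s,r)=s+\mathop{K}_{n=1}^{\infty}\left(\dfrac{(2n-1)^2r^2-(r-1)^2}{2s}\right)$. Then, as $s\to+\infty$, $$y(s,r)\sim s\exp\left\{-\sum_{n=1}^{\infty}\dfrac{\sum_{k=0}^{n}\binom{2n}{2k}(r-1)^{2k}r^{2(n-k)}E_{2(n-k)}}{2n\,s^{2n}}\right\}.$$
   Context: $\mathop{K}_{n=1}^{\infty}\left(\frac{a_n}{b_n}\right)$ denotes the continued fraction $\cfrac{a_1}{b_1+\cfrac{a_2}{b_2+\cdots}}$ (limit of convergents). $E_m$ are the Euler numbers, defined by $\frac{1}{\cosh x}=\sum_{m\ge0}\frac{E_m}{m!}x^m$ (so $E_0=1$, $E_2=-1$, $E_4=5$, odd ones vanish). The relation $y(s)\sim s\exp\{F(s)\}$ with $F$ a formal power series in $1/s$ without constant term means that $y(s)/s$ has the asymptotic (Poincaré) expansion in powers of $1/s$ as $s\to+\infty$ obtained by substituting $F$ into the formal series $\exp(x)=\sum_{m\ge0}x^m/m!$ and collecting coefficients. *)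

(* Defs.v *)
From Stdlib Require Import Reals.
From Coquelicot Require Import Coquelicot.
Open Scope R_scope.

(* Euler numbers: 1/cosh x = sum_m E_m x^m / m!, i.e. E_m is the m-th
   derivative of 1/cosh at 0. *)
Definition euler_num (m : nat) : R := Derive_n (fun x => / cosh x) m 0.

Fixpoint cf_aux (a b : nat -> R) (k n : nat) : R :=
  match n with
  | O => 0
  | S n' => a k / (b k + cf_aux a b (S k) n')
  end.

Definition cf_conv (a b : nat -> R) (N : nat) : R := cf_aux a b 1 N.

Definition cf_value (a b : nat -> R) : R := Lim_seq (cf_conv a b).

Definition a_coef (r : R) (n : nat) : R :=
  (2 * INR n - 1) ^ 2 * r ^ 2 - (r - 1) ^ 2.
Definition b_coef (s : R) (n : nat) : R := 2 * s.

Definition y_fun (r s : R) : R := s + cf_value (a_coef r) (b_coef s).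

(* Formal power series in x = 1/s, represented by coefficient sequences. *)
Definition fps_mul (f g : nat -> R) (m : nat) : R :=
  sum_f_R0 (fun i => f i * g (m - i)%nat) m.

Fixpoint fps_pow (f : nat -> R) (j : nat) : nat -> R :=
  match j with
  | O => fun m => if Nat.eqb m 0 then 1 else 0
  | S j' => fps_mul f (fps_pow f j')
  end.

(* Coefficients of exp(F) for a formal series F without constant term:
   [x^m] sum_j F^j / j!  (only j <= m contribute since F^j = O(x^j)). *)
Definition fps_exp_coef (F : nat -> R) (m : nat) : R :=
  sum_f_R0 (fun j => fps_pow F j m / INR (Stdlib.Arith.Factorial.fact j)) m.

Definition F_coef (r : R) (m : nat) : R :=
  if Nat.even m then
    match Nat.div2 m with
    | O => 0
    | n =>
      - (sum_f_R0 (fun k => Binomial.C (2 * n) (2 * k) * (r - 1) ^ (2 * k)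
                         * r ^ (2 * (n - k)) * euler_num (2 * (n - k))) n)
        / (2 * INR n)
    end
  else 0.

(* Main.v *)
Require Import Defs.
From Stdlib Require Import Reals Factorial Lra Lia.
From Coquelicot Require Import Coquelicot.
Open Scope R_scope.

(* The Bauer-Muir transformation of the continued fraction gives the functional
   equation [y(s) y(s + 2 r) = (s + r)^2 - (r - 1)^2].  With [D = d/ds] its
   logarithm reads [2 cosh(r D) ln y = 2 cosh((r - 1) D) ln] at [s + r], with
   formal solution [cosh((r - 1) D) / cosh(r D)] applied to [ln s], which is
   [ln s] plus the series in the exponent.  By Taylor's formula the truncations
   of that solution satisfy the equation up to a high power of [1 / s], and a
   solution of [u(s) + u(s + 2 r) = R(s)] vanishing at infinity is small when
   [R] is. *)

(** * Continued fractions with positive elements *)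

(** The transformation equates ordinary convergents at [s + 2 r] with modified convergents at [s],
    whose last tail is a positive number instead of 0. Convergence is therefore needed uniformly in
    nonnegative tails. Since the [a_n] grow like n^2, the lower bound obtained for the reciprocal
    gaps between convergents is only logarithmic; it rests on the divergence of the harmonic series.

    The functional equation alone does not determine y: the homogeneous equation u(s) + u(s + 2 r) =
    0 has solutions such as sin(pi s / (2 r)). The missing condition comes from the elementary
    bounds s <= y(s) <= s + a_1 / (2 s), which give ln y(s) - ln s = O(1/s). Passing from the
    equation back to its solution costs two powers of 1/s. This is harmless because the formal
    solution is known to every order: it is truncated two terms later than needed. *)

Fixpoint cf_tail (a b : nat -> R) (k n : nat) (w : R) : R :=
  match n with
  | O => w
  | S n' => a k / (b k + cf_tail a b (S k) n' w)
  end.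

Lemma cf_aux_tail a b n : forall k, cf_aux a b k n = cf_tail a b k n 0.
Proof. induction n as [|n IH]; intros k; simpl; [easy|now rewrite IH]. Qed.

Lemma cf_tail_add a b n m : forall k w,
  cf_tail a b k (n + m) w = cf_tail a b k n (cf_tail a b (k + n) m w).
Proof.
induction n as [|n IH]; intros k w; simpl.
- now rewrite Nat.add_0_r.
- now rewrite IH, Nat.add_succ_r.
Qed.

(** Wallis' three-term recurrence; the pair holds the values of index n - 1 and n. The starting
    pairs (1, 0) and (0, 1) below are the numerators and denominators of index -1 and 0. *)
Fixpoint cf_rec (a b : nat -> R) (x0 x1 : R) (n : nat) : R * R :=
  match n with
  | O => (x0, x1)
  | S m => let p := cf_rec a b x0 x1 m in
           (snd p, b (S m) * snd p + a (S m) * fst p)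
  end.

Definition cf_num a b n := snd (cf_rec a b 1 0 n).
Definition cf_den a b n := snd (cf_rec a b 0 1 n).

Fixpoint prod_to (a : nat -> R) (n : nat) : R :=
  match n with O => 1 | S m => a (S m) * prod_to a m end.

Section PositiveElements.

Variables (a b : nat -> R).
Hypothesis a_pos : forall n, 0 < a n.
Hypothesis b_pos : forall n, 0 < b n.

Lemma cf_tail_ge0 n : forall k w, 0 <= w -> 0 <= cf_tail a b k n w.
Proof.
induction n as [|n IH]; intros k w w0; simpl; [easy|].
apply Rlt_le, Rdiv_lt_0_compat; [apply a_pos|].
specialize (b_pos k); specialize (IH (S k) w w0); lra.
Qed.

Lemma cf_den_SS n :
  cf_den a b (S (S n)) = b (S (S n)) * cf_den a b (S n) + a (S (S n)) * cf_den a b n.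
Proof. reflexivity. Qed.

Lemma cf_num_SS n :
  cf_num a b (S (S n)) = b (S (S n)) * cf_num a b (S n) + a (S (S n)) * cf_num a b n.
Proof. reflexivity. Qed.

Lemma cf_den_pos n : 0 < cf_den a b n.
Proof.
enough (0 < cf_den a b n /\ 0 < cf_den a b (S n)) by tauto.
induction n as [|n [IH1 IH2]].
- unfold cf_den; simpl; specialize (b_pos 1); lra.
- split; [easy|]. rewrite cf_den_SS.
  assert (H1 := Rmult_lt_0_compat _ _ (b_pos (S (S n))) IH2).
  assert (H2 := Rmult_lt_0_compat _ _ (a_pos (S (S n))) IH1).
  lra.
Qed.

Lemma prod_to_pos n : 0 < prod_to a n.
Proof.
induction n as [|n IH]; simpl; [lra|].
now apply Rmult_lt_0_compat.
Qed.

(** In the induction the last partial quotient is absorbed into the tail: the fraction with one more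
    level and tail w is the shorter one with tail a / (b + w), which is again nonnegative. *)
Lemma cf_tail_num_den n : forall w, 0 <= w ->
  cf_tail a b 1 (S n) w
  = (cf_num a b (S n) + w * cf_num a b n) / (cf_den a b (S n) + w * cf_den a b n).
Proof.
induction n as [|n IH]; intros w w0.
- unfold cf_num, cf_den; simpl.
  specialize (b_pos 1); field; lra.
- replace (S (S n)) with (S n + 1)%nat at 1 by lia.
  rewrite cf_tail_add.
  assert (b0 := b_pos (S (S n))).
  assert (a0 := a_pos (S (S n))).
  assert (d0 := cf_den_pos n). assert (d1 := cf_den_pos (S n)).
  simpl cf_tail at 2.
  rewrite IH.
  2: apply Rlt_le, Rdiv_lt_0_compat; simpl; lra.
  rewrite cf_den_SS, cf_num_SS.
  assert (H1 := Rmult_lt_0_compat _ _ b0 d1).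
  assert (H2 := Rmult_lt_0_compat _ _ a0 d0).
  assert (H3 : 0 <= w * cf_den a b (S n)) by (apply Rmult_le_pos; lra).
  simpl Nat.add.
  field; repeat split; nra.
Qed.

(** Each step of the recurrence multiplies the determinant by [- a (S (S n))]. *)
Lemma cf_determinant n :
  Rabs (cf_num a b (S n) * cf_den a b n - cf_num a b n * cf_den a b (S n))
  = prod_to a (S n).
Proof.
induction n as [|n IH].
- unfold cf_num, cf_den; simpl. rewrite Rabs_pos_eq; specialize (a_pos 1); lra.
- rewrite cf_den_SS, cf_num_SS.
  change (prod_to a (S (S n))) with (a (S (S n)) * prod_to a (S n)).
  rewrite <- IH, <- Rabs_Ropp.
  match goal with |- Rabs ?x = _ => replace x with
    (a (S (S n)) * (cf_num a b (S n) * cf_den a b n - cf_num a b n * cf_den a b (S n)))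
    by ring end.
  rewrite Rabs_mult. f_equal. apply Rabs_pos_eq, Rlt_le, a_pos.
Qed.

(* The reciprocal of [|f_(n+1) - f_n|], [f_n] the n-th convergent. *)
Definition cf_gap_inv n := cf_den a b (S n) * cf_den a b n / prod_to a (S n).

Lemma cf_gap_inv_pos n : 0 < cf_gap_inv n.
Proof.
apply Rdiv_lt_0_compat; [|apply prod_to_pos].
apply Rmult_lt_0_compat; apply cf_den_pos.
Qed.

(** The difference is the determinant times w / ((B' + w B) B'), where B, B' are consecutive
    denominators, and w / (B' + w B) <= 1 / B. The bound does not depend on w. *)
Lemma cf_tail_dist n w : 0 <= w ->
  Rabs (cf_tail a b 1 (S n) w - cf_tail a b 1 (S n) 0) <= / cf_gap_inv n.
Proof.
intros w0.
rewrite !cf_tail_num_den by lra.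
assert (d0 := cf_den_pos n). assert (d1 := cf_den_pos (S n)).
assert (H3 : 0 <= w * cf_den a b n) by (apply Rmult_le_pos; lra).
unfold cf_gap_inv. rewrite Rinv_div, <- cf_determinant.
match goal with |- Rabs ?x <= _ => replace x with
  ((cf_num a b n * cf_den a b (S n) - cf_num a b (S n) * cf_den a b n) *
   (w / ((cf_den a b (S n) + w * cf_den a b n) * cf_den a b (S n)))) by (field; nra) end.
rewrite Rabs_mult, <- Rabs_Ropp, Ropp_minus_distr.
apply Rmult_le_compat_l; [apply Rabs_pos|].
rewrite Rabs_pos_eq by (apply Rdiv_le_0_compat; nra).
apply (Rmult_le_reg_r ((cf_den a b (S n) + w * cf_den a b n) * cf_den a b (S n) * cf_den a b n)).
- repeat apply Rmult_lt_0_compat; lra.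
- field_simplify; [|lra|nra].
  nra.
Qed.

Variables (beta c : R).
Hypothesis beta_pos : 0 < beta.
Hypothesis b_ge : forall n, beta <= b n.
Hypothesis c_pos : 0 < c.
Hypothesis a_le : forall n, a (S n) <= (c * INR (S n)) ^ 2.

Lemma cf_gap_inv_S n :
  cf_gap_inv (S n) = cf_gap_inv n + b (S (S n)) * cf_den a b (S n) ^ 2 / prod_to a (S (S n)).
Proof.
unfold cf_gap_inv. rewrite cf_den_SS.
change (prod_to a (S (S n))) with (a (S (S n)) * prod_to a (S n)).
assert (H := prod_to_pos (S n)); assert (H1 := a_pos (S (S n))).
field; lra.
Qed.

Lemma cf_gap_inv_incr n : cf_gap_inv n <= cf_gap_inv (S n).
Proof.
rewrite cf_gap_inv_S.
assert (0 <= b (S (S n)) * cf_den a b (S n) ^ 2 / prod_to a (S (S n))); [|lra].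
apply Rdiv_le_0_compat; [|apply prod_to_pos].
apply Rmult_le_pos; [apply Rlt_le, b_pos|apply pow2_ge_0].
Qed.

(** The sum of two consecutive increments is bounded below, by the inequality between arithmetic and
    geometric means, by a multiple of the product of two consecutive denominators, which is
    [cf_gap_inv (S n)] again. With [a_n <= (c n)^2] the relative growth is at least of order 1/n. *)
Lemma cf_gap_inv_SS n :
  cf_gap_inv n + 2 * beta * cf_gap_inv (S n) / (c * INR (S (S (S n)))) <= cf_gap_inv (S (S n)).
Proof.
rewrite (cf_gap_inv_S (S n)), (cf_gap_inv_S n), Rplus_assoc.
apply Rplus_le_compat_l.
rewrite <- cf_gap_inv_S. unfold cf_gap_inv.
set (P := prod_to a (S (S n))).
change (prod_to a (S (S (S n)))) with (a (S (S (S n))) * P).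
assert (HP : 0 < P) by apply prod_to_pos.
set (x := cf_den a b (S n)). set (y := cf_den a b (S (S n))).
assert (x0 : 0 < x) by apply cf_den_pos.
assert (y0 : 0 < y) by apply cf_den_pos.
assert (a0 := a_pos (S (S (S n)))).
assert (a1 := a_le (S (S n))).
set (d := c * INR (S (S (S n)))) in *.
assert (d0 : 0 < d) by (apply Rmult_lt_0_compat; [easy|apply lt_0_INR; lia]).
set (A := a (S (S (S n)))) in *.
assert (b1 := b_ge (S (S n))). assert (b2 := b_ge (S (S (S n)))).
set (B1 := b (S (S n))) in *. set (B2 := b (S (S (S n)))) in *.
(* x^2 + y^2/A >= x^2 + y^2/d^2 >= 2 x y / d *)
assert (E1 : y ^ 2 / d ^ 2 <= y ^ 2 / A).
{ apply Rmult_le_compat_l; [apply pow2_ge_0|]. apply Rinv_le_contravar; easy. }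
assert (E2 : 2 * x * y / d <= x ^ 2 + y ^ 2 / d ^ 2).
{ assert (H := pow2_ge_0 (x - y / d)).
  replace ((x - y / d) ^ 2) with (x ^ 2 + y ^ 2 / d ^ 2 - 2 * x * y / d) in H by (field; lra).
  lra. }
assert (E3 : 0 <= y ^ 2 / A) by (apply Rdiv_le_0_compat; [apply pow2_ge_0|easy]).
apply (Rmult_le_reg_r P); [easy|].
replace (2 * beta * (y * x / P) / d * P) with (beta * (2 * x * y / d)) by (field; lra).
replace ((B1 * x ^ 2 / P + B2 * y ^ 2 / (A * P)) * P)
  with (B1 * x ^ 2 + B2 * (y ^ 2 / A)) by (field; lra).
assert (0 <= (B1 - beta) * x ^ 2) by (apply Rmult_le_pos; [lra|apply pow2_ge_0]).
assert (0 <= (B2 - beta) * (y ^ 2 / A)) by (apply Rmult_le_pos; lra).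
assert (beta * (2 * x * y / d) <= beta * (x ^ 2 + y ^ 2 / A)).
{ apply Rmult_le_compat_l; lra. }
lra.
Qed.

(* [ln] is the telescoping form of the harmonic lower bound given by [cf_gap_inv_SS]. *)
Lemma cf_gap_inv_ge_ln n :
  2 * beta * cf_gap_inv 0 / c * (ln (INR (n + 3)) - ln 3) <= 2 * cf_gap_inv (S n).
Proof.
(* [cf_gap_inv_SS] advances by two indices; for the sum of two neighbours it becomes a one-step
   recurrence suited to induction. *)
enough (H : 2 * beta * cf_gap_inv 0 / c * (ln (INR (n + 3)) - ln 3)
        <= cf_gap_inv n + cf_gap_inv (S n)) by (assert (H1 := cf_gap_inv_incr n); lra).
assert (Q0 := cf_gap_inv_pos 0).
induction n as [|n IH].
- replace (INR (0 + 3)) with 3 by (simpl; lra).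
  assert (Q1 := cf_gap_inv_pos 1). lra.
- assert (H := cf_gap_inv_SS n).
  assert (Q1 : cf_gap_inv 0 <= cf_gap_inv (S n)).
  { clear -a_pos b_pos. induction n as [|n IH]; [apply cf_gap_inv_incr|].
    assert (H := cf_gap_inv_incr (S n)); lra. }
  assert (i0 : 0 < INR (n + 3)) by (apply lt_0_INR; lia).
  assert (L : ln (INR (S n + 3)) - ln (INR (n + 3)) <= / INR (n + 3)).
  { replace (INR (S n + 3)) with (INR (n + 3) + 1)
      by (rewrite <- S_INR; f_equal; lia).
    rewrite <- ln_div by lra.
    replace ((INR (n + 3) + 1) / INR (n + 3)) with (1 + / INR (n + 3)) by (field; lra).
    assert (i1 := Rinv_0_lt_compat _ i0).
    apply Rlt_le. rewrite <- (ln_exp (/ INR (n + 3))) at 2.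
    apply ln_increasing; [lra|]. apply exp_ineq1; lra. }
  assert (E : 2 * beta * cf_gap_inv 0 / c * (ln (INR (S n + 3)) - ln (INR (n + 3)))
     <= 2 * beta * cf_gap_inv (S n) / (c * INR (S (S (S n))))).
  { replace (S (S (S n))) with (n + 3)%nat by lia.
    replace (2 * beta * cf_gap_inv (S n) / (c * INR (n + 3)))
      with (2 * beta * cf_gap_inv (S n) / c * / INR (n + 3)) by (field; lra).
    apply Rle_trans with (2 * beta * cf_gap_inv 0 / c * / INR (n + 3)).
    - apply Rmult_le_compat_l; [|easy].
      apply Rdiv_le_0_compat; [nra|easy].
    - apply Rmult_le_compat_r; [now apply Rlt_le, Rinv_0_lt_compat|].
      apply Rmult_le_compat_r; [now apply Rlt_le, Rinv_0_lt_compat|].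
      apply Rmult_le_compat_l; lra. }
  lra.
Qed.

Lemma is_lim_seq_gap : is_lim_seq (fun n => / cf_gap_inv n) 0.
Proof.
apply is_lim_seq_incr_1.
replace (Finite 0) with (Rbar_inv p_infty) by reflexivity.
apply is_lim_seq_inv; [|easy].
apply is_lim_seq_le_p_loc with
  (fun n => beta * cf_gap_inv 0 / c * (ln (INR (n + 3)) - ln 3)).
- exists 0%nat; intros n _. assert (H := cf_gap_inv_ge_ln n). lra.
- assert (K : 0 < beta * cf_gap_inv 0 / c).
  { apply Rdiv_lt_0_compat; [apply Rmult_lt_0_compat; [easy|apply cf_gap_inv_pos]|easy]. }
  eapply is_lim_seq_mult.
  + apply is_lim_seq_const.
  + eapply is_lim_seq_minus.
    * apply (is_lim_seq_incr_n (fun n => ln (INR n)) 3).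
      apply (is_lim_comp_seq ln INR p_infty p_infty).
      -- apply is_lim_ln_p.
      -- exists 0%nat; intros; discriminate.
      -- apply is_lim_seq_INR.
    * apply is_lim_seq_const.
    * reflexivity.
  + now apply is_Rbar_mult_sym, is_Rbar_mult_p_infty_pos.
Qed.

(** The longer fraction is the shorter one with another nonnegative tail, so both lie within the
    bound of [cf_tail_dist] from the tail 0. *)
Lemma cf_tail_cauchy n w m w' : 0 <= w -> 0 <= w' -> (n <= m)%nat ->
  Rabs (cf_tail a b 1 (S m) w' - cf_tail a b 1 (S n) w) <= 2 * / cf_gap_inv n.
Proof.
intros w0 w0' nm.
replace (S m) with (S n + (m - n))%nat by lia.
rewrite cf_tail_add.
assert (H := cf_tail_ge0 (m - n) (1 + S n) w' w0').
assert (H1 := cf_tail_dist n _ H). assert (H2 := cf_tail_dist n w w0).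
revert H1 H2. unfold Rabs; repeat destruct Rcase_abs; lra.
Qed.

Lemma cf_tail_converges : exists l : R, 0 <= l /\
  forall w, (forall n, 0 <= w n) -> is_lim_seq (fun n => cf_tail a b 1 n (w n)) l.
Proof.
assert (G := is_lim_seq_gap).
apply is_lim_seq_spec in G. simpl in G.
assert (E : ex_finite_lim_seq (fun n => cf_tail a b 1 (S n) 0)).
{ apply ex_lim_seq_cauchy_corr. intros eps.
  (* A quarter of [eps]: both indices are compared with N, each at the cost of twice the gap. *)
  destruct (G (pos_div_2 (pos_div_2 eps))) as [N HN].
  exists N. intros n m Hn Hm.
  specialize (HN N (Nat.le_refl N)).
  rewrite Rminus_0_r, Rabs_pos_eq in HN by (apply Rlt_le, Rinv_0_lt_compat, cf_gap_inv_pos).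
  simpl in HN.
  assert (H1 := cf_tail_cauchy N 0 n 0 (Rle_refl 0) (Rle_refl 0) Hn).
  assert (H2 := cf_tail_cauchy N 0 m 0 (Rle_refl 0) (Rle_refl 0) Hm).
  revert H1 H2. unfold Rabs; repeat destruct Rcase_abs; lra. }
destruct E as [l Hl].
exists l. split.
- assert (H : Rbar_le 0 l).
  { eapply is_lim_seq_le; [|apply (is_lim_seq_const 0)|exact Hl].
    intros n; apply cf_tail_ge0; lra. }
  exact H.
- intros w w0. apply is_lim_seq_incr_1.
  apply is_lim_seq_ext with
    (fun n => cf_tail a b 1 (S n) 0
              + (cf_tail a b 1 (S n) (w (S n)) - cf_tail a b 1 (S n) 0)).
  { intros n; ring. }
  replace (Finite l) with (Rbar_plus l 0) by (simpl; now rewrite Rplus_0_r).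
  apply is_lim_seq_plus'; [exact Hl|].
  apply is_lim_seq_abs_0.
  eapply is_lim_seq_le_le; [|apply (is_lim_seq_const 0)|exact is_lim_seq_gap].
  intros n; split; [apply Rabs_pos|]. apply cf_tail_dist, w0.
Qed.

End PositiveElements.

(** * The functional equation *)

(** The condition on r amounts to (r - 1)^2 < r^2, and (2 n - 1)^2 >= 1 also at n = 0. *)
Lemma a_coef_pos r n : 1 / 2 < r -> 0 < a_coef r n.
Proof.
intros hr. unfold a_coef.
assert (H : 1 <= (2 * INR n - 1) ^ 2).
{ destruct n as [|n]; [simpl; lra|].
  rewrite S_INR. assert (H := pos_INR n). nra. }
assert (0 <= ((2 * INR n - 1) ^ 2 - 1) * r ^ 2)
  by (apply Rmult_le_pos; [lra|apply pow2_ge_0]).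
nra.
Qed.

Lemma a_coef_le r n : 1 / 2 < r -> a_coef r (S n) <= (2 * r * INR (S n)) ^ 2.
Proof.
intros hr. unfold a_coef. rewrite S_INR.
assert (H := pos_INR n). assert (H1 := pow2_ge_0 (r - 1)).
assert (0 <= (4 * INR n + 3) * r ^ 2)
  by (apply Rmult_le_pos; [lra|apply pow2_ge_0]).
nra.
Qed.

(* Finite form of the Bauer-Muir transformation of [s + K(a_n / 2s)] with
   modifying factors [w_n = 2 r n - s]: then [a_n - w_(n-1) (2 s + w_n)] is the
   constant [(s + r)^2 - (r - 1)^2], and the transformed fraction is the
   original one at [s + 2 r]. *)
Lemma bauer_muir r s n : 1 / 2 < r -> 0 < s -> forall k,
  cf_tail (a_coef r) (b_coef s) (S k) n
    (a_coef r (S (k + n)) / (s + 2 * r * INR (S (k + n))))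
  = 2 * r * INR k - s
    + ((s + r) ^ 2 - (r - 1) ^ 2)
      / (s + 2 * r * INR (S k) + cf_aux (a_coef r) (b_coef (s + 2 * r)) (S k) n).
Proof.
intros hr hs.
assert (lam0 : 0 < (s + r) ^ 2 - (r - 1) ^ 2) by nra.
induction n as [|n IH]; intros k.
- cbn [cf_tail cf_aux]. rewrite Nat.add_0_r. unfold a_coef. rewrite S_INR.
  assert (H := pos_INR k). assert (H1 : 0 <= r * INR k) by (apply Rmult_le_pos; lra).
  field; lra.
- cbn [cf_tail cf_aux].
  replace (k + S n)%nat with (S k + n)%nat by lia.
  rewrite IH.
  assert (H := pos_INR k). assert (H1 : 0 <= r * INR k) by (apply Rmult_le_pos; lra).
  rewrite cf_aux_tail.
  set (T := cf_tail _ _ _ _ _).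
  assert (T0 : 0 <= T).
  { apply cf_tail_ge0; [intros; now apply a_coef_pos|intros; unfold b_coef; lra|lra]. }
  assert (A0 := a_coef_pos r (S k) hr).
  unfold b_coef. rewrite !S_INR.
  (* P is 2 s + w_(k+1), so that [EA] below is the identity a_(k+1) = lam + w_k (2 s + w_(k+1))
     behind the transformation. *)
  set (P := s + 2 * r * (INR k + 1)).
  assert (P0 : 0 < P) by (unfold P; nra).
  assert (EA : a_coef r (S k) = (s + r) ^ 2 - (r - 1) ^ 2 + (P - 2 * s - 2 * r) * P).
  { unfold a_coef, P. rewrite S_INR. ring. }
  assert (E2 : s + 2 * r * (INR k + 1 + 1) = P + 2 * r) by (unfold P; ring).
  assert (E3 : 2 * r * INR k - s = P - 2 * s - 2 * r) by (unfold P; ring).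
  assert (E4 : 2 * r * (INR k + 1) - s = P - 2 * s) by (unfold P; ring).
  rewrite E2, E3, E4.
  set (A := a_coef r (S k)) in *. set (lam := (s + r) ^ 2 - (r - 1) ^ 2) in *.
  assert (N1 : 0 < P * (P + 2 * r + T) + lam) by nra.
  assert (N2 : 0 < P * (2 * (s + 2 * r) + T) + A) by nra.
  transitivity (A * (P + 2 * r + T) / (P * (P + 2 * r + T) + lam)).
  { field. split; [|lra]. nra. }
  (* Eliminating [lam] makes the denominators in [N1] and [N2] the same expression. *)
  assert (EL : lam = A - (P - 2 * s - 2 * r) * P) by (rewrite EA; ring).
  clearbody A lam P. rewrite EL in *.
  field. repeat split; nra.
Qed.

Section YFun.
Variable r : R.
Hypothesis hr : 1 / 2 < r.

Lemma cf_tail_a_coef_converges s : 0 < s -> exists l : R, 0 <= l /\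
  forall w, (forall n, 0 <= w n) ->
  is_lim_seq (fun n => cf_tail (a_coef r) (b_coef s) 1 n (w n)) l.
Proof.
intros hs.
apply cf_tail_converges with (beta := 2 * s) (c := 2 * r); unfold b_coef.
- intros n; now apply a_coef_pos.
- intros _; lra.
- lra.
- intros _; lra.
- lra.
- intros n; now apply a_coef_le.
Qed.

Lemma cf_conv_a_coef_converges s : 0 < s ->
  ex_finite_lim_seq (cf_conv (a_coef r) (b_coef s)).
Proof.
intros hs. destruct (cf_tail_a_coef_converges s hs) as [l [_ Hl]].
exists l. eapply is_lim_seq_ext; [|apply (Hl (fun _ => 0)); intros; lra].
intros n; unfold cf_conv; now rewrite cf_aux_tail.
Qed.

Lemma y_fun_modified_limit s w : 0 < s -> (forall n, 0 <= w n) ->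
  is_lim_seq (fun n => s + cf_tail (a_coef r) (b_coef s) 1 n (w n)) (y_fun r s).
Proof.
intros hs hw. destruct (cf_tail_a_coef_converges s hs) as [l [_ Hl]].
unfold y_fun, cf_value.
rewrite (is_lim_seq_unique _ l).
- apply is_lim_seq_plus'; [apply is_lim_seq_const|now apply Hl].
- eapply is_lim_seq_ext; [|apply (Hl (fun _ => 0)); intros; lra].
  intros n; unfold cf_conv; now rewrite cf_aux_tail.
Qed.

(** The tail after the first numerator is nonnegative, hence the first denominator is at least 2
    s. *)
Lemma y_fun_bounds s : 0 < s -> s <= y_fun r s <= s + a_coef r 1 / (2 * s).
Proof.
intros hs.
assert (H := y_fun_modified_limit s (fun _ => 0) hs (fun _ => Rle_refl 0)).
apply is_lim_seq_incr_1 in H.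
assert (B : forall n, 0 <= cf_tail (a_coef r) (b_coef s) 1 (S n) 0 <= a_coef r 1 / (2 * s)).
{ assert (G : forall n k, 0 <= cf_tail (a_coef r) (b_coef s) k n 0).
  { intros n k; apply cf_tail_ge0; [intros; now apply a_coef_pos|intros; unfold b_coef; lra|lra]. }
  intros n; split; [apply G|].
  simpl. apply Rmult_le_compat_l; [now apply Rlt_le, a_coef_pos|].
  apply Rinv_le_contravar; [lra|]. specialize (G n 2%nat). unfold b_coef in *. lra. }
split.
- assert (K : Rbar_le s (y_fun r s)); [|exact K].
  eapply is_lim_seq_le; [|apply (is_lim_seq_const s)|exact H].
  intros n; specialize (B n); simpl in *; lra.
- assert (K : Rbar_le (y_fun r s) (s + a_coef r 1 / (2 * s))); [|exact K].
  eapply is_lim_seq_le; [|exact H|apply is_lim_seq_const].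
  intros n; specialize (B n); simpl in *; lra.
Qed.

(** Limit of [bauer_muir] at k = 0, where the term -s cancels against the leading s of y. Its tails
    [W0] are nonnegative, so the modified convergents still tend to y(s). *)
Lemma y_fun_functional_equation s : 0 < s ->
  y_fun r s * y_fun r (s + 2 * r) = (s + r) ^ 2 - (r - 1) ^ 2.
Proof.
intros hs.
assert (hs' : 0 < s + 2 * r) by lra.
assert (B := y_fun_bounds _ hs').
assert (W0 : forall n, 0 <= a_coef r (S n) / (s + 2 * r * INR (S n))).
{ intros n. apply Rlt_le, Rdiv_lt_0_compat; [now apply a_coef_pos|].
  assert (H := pos_INR (S n)). nra. }
assert (H := y_fun_modified_limit s _ hs W0).
assert (H' := y_fun_modified_limit _ (fun _ => 0) hs' (fun _ => Rle_refl 0)).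
assert (H2 : is_lim_seq (fun n => ((s + r) ^ 2 - (r - 1) ^ 2)
    / (s + 2 * r + cf_tail (a_coef r) (b_coef (s + 2 * r)) 1 n 0))
    (((s + r) ^ 2 - (r - 1) ^ 2) / y_fun r (s + 2 * r))).
{ apply is_lim_seq_div'; [apply is_lim_seq_const|exact H'|lra]. }
apply (is_lim_seq_ext _ (fun n => s + cf_tail (a_coef r) (b_coef s) 1 n
         (a_coef r (S n) / (s + 2 * r * INR (S n))))) in H2.
- apply is_lim_seq_unique in H. apply is_lim_seq_unique in H2.
  assert (E : Finite (y_fun r s) = Finite (((s + r) ^ 2 - (r - 1) ^ 2) / y_fun r (s + 2 * r)))
    by congruence.
  injection E as E. rewrite E. field. lra.
- intros n. assert (BM := bauer_muir r s n hr hs 0). simpl Nat.add in BM. rewrite BM.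
  rewrite <- cf_aux_tail. simpl INR. rewrite Rmult_1_r. ring.
Qed.

End YFun.

(** * Cauchy products and Euler numbers *)

(* Coquelicot lemmas state equalities in the carrier of a structure, which
   [ring] and [field] do not recognise as [R]. *)
Ltac eqR := match goal with |- ?a = ?b => change (@eq R a b) end.

Lemma sum_triangle (f : nat -> nat -> R) N :
  sum_f_R0 (fun n => sum_f_R0 (f n) (N - n)) N
  = sum_f_R0 (fun m => sum_f_R0 (fun n => f n (m - n)%nat) m) N.
Proof.
induction N as [|N IH]; [reflexivity|].
rewrite !tech5, <- IH, Nat.sub_diag. simpl (sum_f_R0 (f (S N)) 0).
rewrite (sum_eq _ (fun n => sum_f_R0 (f n) (N - n) + f n (S N - n)%nat)).
- rewrite sum_plus. ring.
- intros n Hn. now rewrite Nat.sub_succ_l.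
Qed.

Lemma sum_exchange (f : nat -> nat -> R) n m :
  sum_f_R0 (fun i => sum_f_R0 (f i) m) n = sum_f_R0 (fun j => sum_f_R0 (fun i => f i j) n) m.
Proof.
induction n as [|n IH]; [reflexivity|].
simpl. now rewrite IH, <- sum_plus.
Qed.

Lemma sum_even (f : nat -> R) n : (forall k, Nat.odd k = true -> f k = 0) ->
  sum_f_R0 f (2 * n) = sum_f_R0 (fun k => f (2 * k)%nat) n.
Proof.
intros H. induction n as [|n IH]; [reflexivity|].
replace (2 * S n)%nat with (S (S (2 * n))) by lia.
rewrite !tech5, IH. replace (2 * S n)%nat with (S (S (2 * n))) by lia.
rewrite (H (S (2 * n))); [ring|].
rewrite Nat.odd_succ. apply Nat.even_spec. now exists n.
Qed.

Lemma fps_mul_ext f f' g g' m :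
  (forall i, (i <= m)%nat -> f i = f' i) -> (forall i, (i <= m)%nat -> g i = g' i) ->
  fps_mul f g m = fps_mul f' g' m.
Proof.
intros Hf Hg. apply sum_eq. intros i Hi. rewrite Hf, Hg; [easy|lia|lia].
Qed.

Lemma fps_mul_assoc f g h m :
  fps_mul (fps_mul f g) h m = fps_mul f (fps_mul g h) m.
Proof.
unfold fps_mul.
transitivity (sum_f_R0 (fun n => sum_f_R0 (fun j => f n * (g j * h (m - n - j)%nat)) (m - n)) m).
- rewrite sum_triangle. apply sum_eq. intros p Hp.
  rewrite Rmult_comm, scal_sum. apply sum_eq. intros i Hi.
  replace (m - i - (p - i))%nat with (m - p)%nat by lia. ring.
- apply sum_eq. intros i Hi. rewrite scal_sum. apply sum_eq. intros; ring.
Qed.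

Lemma fps_mul_1_r f m : fps_mul f (fps_pow f 0) m = f m.
Proof.
unfold fps_mul. destruct m as [|m]; [simpl; ring|].
rewrite tech5, Nat.sub_diag, (sum_eq _ (fun _ => 0)).
- rewrite sum_cte. simpl. ring.
- intros i Hi. change (fps_pow f 0 (S m - i)) with (if Nat.eqb (S m - i) 0 then 1 else 0).
  destruct (Nat.eqb_spec (S m - i) 0); [lia|ring].
Qed.

Lemma fps_mul_scale f g h m :
  fps_mul (fun k => h ^ k * f k) (fun k => h ^ k * g k) m = h ^ m * fps_mul f g m.
Proof.
unfold fps_mul. rewrite scal_sum. apply sum_eq. intros i Hi.
replace (h ^ m) with (h ^ i * h ^ (m - i)) by (rewrite <- pow_add; f_equal; lia).
ring.
Qed.

(* [f k] is the [k]-th derivative of [f 0] divided by [k!]; with this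
   normalisation Leibniz's rule is the Cauchy product. *)
Definition taylor_jet (f : nat -> R -> R) :=
  forall k x, is_derive (f k) x (INR (S k) * f (S k) x).

Lemma is_derive_sum_f_R0 (f f' : nat -> R -> R) n x :
  (forall k, (k <= n)%nat -> is_derive (f k) x (f' k x)) ->
  is_derive (fun y => sum_f_R0 (fun k => f k y) n) x (sum_f_R0 (fun k => f' k x) n).
Proof.
induction n as [|n IH]; intros H; simpl.
- now apply (H 0%nat).
- apply @is_derive_plus; [apply IH; intros; apply H; lia|now apply H].
Qed.

(** In the i-th term of the product of index m + 1, the factor m + 1 splits as i + (m + 1 - i). The
    two parts are the derivatives of f and of g up to a shift of index, and their boundary terms
    vanish. *)
Lemma taylor_jet_mul f g : taylor_jet f -> taylor_jet g ->
  taylor_jet (fun m x => fps_mul (fun i => f i x) (fun i => g i x) m).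
Proof.
intros Hf Hg m x. unfold fps_mul.
assert (D : is_derive (fun y => sum_f_R0 (fun i => f i y * g (m - i)%nat y) m) x
  (sum_f_R0 (fun i => INR (S i) * f (S i) x * g (m - i)%nat x
                      + f i x * (INR (S (m - i)) * g (S (m - i)) x)) m)).
{ apply (is_derive_sum_f_R0 (fun i y => f i y * g (m - i)%nat y)
   (fun i y => INR (S i) * f (S i) y * g (m - i)%nat y
                      + f i y * (INR (S (m - i)) * g (S (m - i)) y))).
  intros k Hk. apply (is_derive_mult (f k) (g (m - k)%nat)); [apply Hf|apply Hg|].
  intros; apply Rmult_comm. }
replace (INR (S m) * sum_f_R0 (fun i => f i x * g (S m - i)%nat x) (S m)) with
  (sum_f_R0 (fun i => INR (S i) * f (S i) x * g (m - i)%nat x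
                      + f i x * (INR (S (m - i)) * g (S (m - i)) x)) m); [exact D|].
rewrite sum_plus, scal_sum.
rewrite (sum_eq (fun i => f i x * g (S m - i)%nat x * INR (S m))
   (fun i => INR i * f i x * g (S m - i)%nat x + f i x * (INR (S m - i) * g (S m - i)%nat x))).
- rewrite sum_plus. f_equal.
  + rewrite (decomp_sum (fun i => INR i * f i x * g (S m - i)%nat x)) by lia.
    simpl Nat.pred. simpl INR at 2. rewrite !Rmult_0_l, Rplus_0_l.
    apply sum_eq. intros i Hi. reflexivity.
  + rewrite tech5, Nat.sub_diag. simpl INR at 3. rewrite Rmult_0_l, Rmult_0_r, Rplus_0_r.
    apply sum_eq. intros i Hi. now rewrite Nat.sub_succ_l.
- intros i Hi. rewrite minus_INR by easy. ring.
Qed.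

Lemma taylor_jet_const f c : taylor_jet f -> (forall x, f 0%nat x = c) ->
  forall n x, f (S n) x = 0.
Proof.
intros Hf H0.
assert (Step : forall k d, (forall x, f k x = d) -> forall x, f (S k) x = 0).
{ intros k d Hd x. assert (H := Hf k x).
  apply (is_derive_ext _ (fun _ => d)) in H; [|easy].
  apply is_derive_unique in H. rewrite Derive_const in H.
  symmetry in H. apply Rmult_integral in H. destruct H as [H|H]; [|easy].
  apply (not_INR (S k) 0) in H; [easy|lia]. }
induction n as [|n IH]; [exact (Step 0%nat c H0)|exact (Step _ 0 IH)].
Qed.

(** A class containing 1 / cosh and closed under differentiation. It shows that 1 / cosh is smooth,
    without which the total function [Derive_n] carries no information. Writing the derivative of
    tanh as sech^2 avoids constants. *)
Inductive sech_tanh : (R -> R) -> Prop :=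
| sech_tanh_sech : sech_tanh (fun x => / cosh x)
| sech_tanh_tanh : sech_tanh (fun x => sinh x / cosh x)
| sech_tanh_opp f : sech_tanh f -> sech_tanh (fun x => - f x)
| sech_tanh_add f g : sech_tanh f -> sech_tanh g -> sech_tanh (fun x => f x + g x)
| sech_tanh_mul f g : sech_tanh f -> sech_tanh g -> sech_tanh (fun x => f x * g x).

Lemma cosh_pos x : 0 < cosh x.
Proof.
unfold cosh. assert (H := exp_pos x). assert (H1 := exp_pos (- x)). lra.
Qed.

Lemma sech_tanh_derive f : sech_tanh f ->
  exists f', sech_tanh f' /\ forall x, is_derive f x (f' x).
Proof.
intros H; induction H as [| |f Hf [f' [Sf Df]]|f g Hf [f' [Sf Df]] Hg [g' [Sg Dg]]
   |f g Hf [f' [Sf Df]] Hg [g' [Sg Dg]]].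
- exists (fun x => - (sinh x / cosh x * / cosh x)). split.
  + apply (sech_tanh_opp (fun x => sinh x / cosh x * / cosh x)).
    apply (sech_tanh_mul (fun x => sinh x / cosh x)); constructor.
  + intros x. assert (H := cosh_pos x). auto_derive; [lra|field; lra].
- exists (fun x => / cosh x * / cosh x). split.
  + apply (sech_tanh_mul (fun x => / cosh x)); constructor.
  + intros x. assert (H := cosh_pos x). auto_derive; [lra|].
    assert (E : cosh x * cosh x - sinh x * sinh x = 1).
    { unfold cosh, sinh. rewrite exp_Ropp. assert (E := exp_pos x). field; lra. }
    apply (Rmult_eq_reg_r (cosh x ^ 2)); [|apply Rgt_not_eq, pow_lt, H].
    field_simplify; [nra|lra|lra].
- exists (fun x => - f' x). split; [now constructor|].
  intros x. apply (is_derive_opp f), Df.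
- exists (fun x => f' x + g' x). split; [now constructor|].
  intros x. apply (is_derive_plus f g); [apply Df|apply Dg].
- exists (fun x => f' x * g x + f x * g' x). split.
  + apply (sech_tanh_add (fun x => f' x * g x)); constructor; easy.
  + intros x. apply (is_derive_mult f g); [apply Df|apply Dg|intros; apply Rmult_comm].
Qed.

Lemma sech_tanh_Derive_n n : exists f, sech_tanh f /\
  forall x, Derive_n (fun x => / cosh x) n x = f x.
Proof.
induction n as [|n [f [Hf E]]].
- exists (fun x => / cosh x). split; [constructor|easy].
- destruct (sech_tanh_derive f Hf) as [f' [Hf' D]].
  exists f'. split; [easy|]. intros x. simpl.
  rewrite (Derive_ext _ f); [|exact E]. apply is_derive_unique, D.
Qed.

Lemma ex_derive_Derive_n_sech n x : ex_derive (Derive_n (fun x => / cosh x) n) x.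
Proof.
destruct (sech_tanh_Derive_n n) as [f [Hf E]].
destruct (sech_tanh_derive f Hf) as [f' [_ D]].
apply (ex_derive_ext f); [intros; now rewrite E|exists (f' x); apply D].
Qed.

Lemma taylor_jet_sech :
  taylor_jet (fun k x => Derive_n (fun x => / cosh x) k x / INR (fact k)).
Proof.
intros k x.
replace (INR (S k) * (Derive_n (fun x => / cosh x) (S k) x / INR (fact (S k))))
  with (scal (/ INR (fact k)) (Derive (Derive_n (fun x => / cosh x) k) x)).
- apply (is_derive_ext (fun y => scal (/ INR (fact k)) (Derive_n (fun x => / cosh x) k y))).
  + intros t. unfold scal; simpl; unfold mult; simpl. apply Rmult_comm.
  + apply (is_derive_scal (Derive_n (fun x => / cosh x) k)).
    apply Derive_correct, ex_derive_Derive_n_sech.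
- rewrite fact_simpl, mult_INR.
  change (Derive_n (fun x => / cosh x) (S k) x) with (Derive (Derive_n (fun x => / cosh x) k) x).
  unfold scal; cbn -[Derive_n Derive INR]; unfold mult; cbn -[Derive_n Derive INR]. eqR.
  field. split; [apply INR_fact_neq_0|apply not_0_INR; lia].
Qed.

Lemma taylor_jet_cosh :
  taylor_jet (fun k x => (if Nat.even k then cosh x else sinh x) / INR (fact k)).
Proof.
intros k x. rewrite Nat.even_succ, <- Nat.negb_even, fact_simpl, mult_INR.
assert (F := INR_fact_neq_0 k). assert (S0 : INR (S k) <> 0) by (apply not_0_INR; lia).
destruct (Nat.even k); simpl negb; cbv iota;
  auto_derive; try easy; field; easy.
Qed.

(* Taylor coefficients of [cosh (h t)] and of [1 / cosh (h t)] at [t = 0]. *)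
Definition cosh_coef (h : R) (k : nat) := if Nat.even k then h ^ k / INR (fact k) else 0.
Definition sech_coef (h : R) (k : nat) := h ^ k * (euler_num k / INR (fact k)).

(** The product of the jets of 1 / cosh and cosh is a jet of the constant 1, so its higher terms
    vanish; this is evaluated at 0 and rescaled by h. *)
Lemma sech_cosh_coef h m : fps_mul (sech_coef h) (cosh_coef h) m = fps_pow (sech_coef h) 0 m.
Proof.
assert (J := taylor_jet_mul _ _ taylor_jet_sech taylor_jet_cosh).
rewrite (fps_mul_ext _ (fun k => h ^ k * (euler_num k / INR (fact k))) _
  (fun k => h ^ k * ((if Nat.even k then cosh 0 else sinh 0) / INR (fact k)))).
- rewrite fps_mul_scale. destruct m as [|m].
  + unfold fps_mul, euler_num; simpl. rewrite cosh_0. field.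
  + unfold euler_num. rewrite (taylor_jet_const _ 1 J).
    * simpl; ring.
    * intros x. unfold fps_mul; simpl. assert (H := cosh_pos x). field; lra.
- easy.
- intros i _. unfold cosh_coef. rewrite cosh_0, sinh_0.
  destruct (Nat.even i); unfold Rdiv; ring.
Qed.

Lemma euler_num_odd m : Nat.odd m = true -> euler_num m = 0.
Proof.
intros Hm. unfold euler_num.
assert (E : Derive_n (fun x => / cosh x) m 0 = (-1) ^ m * Derive_n (fun x => / cosh x) m (- 0)).
{ rewrite <- Derive_n_comp_opp.
  - apply Derive_n_ext. intros t. unfold cosh. now rewrite Ropp_involutive, Rplus_comm.
  - apply filter_forall. intros y k _. destruct k as [|k]; [easy|].
    apply ex_derive_Derive_n_sech. }
rewrite Ropp_0 in E. apply Nat.odd_spec in Hm. destruct Hm as [k ->].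
rewrite Nat.add_1_r in *. rewrite pow_1_odd in E. lra.
Qed.

(** * Orders of magnitude at infinity and Taylor's formula *)

(** This sum is f(1) at u = 1 and the Taylor polynomial at u = 0; its derivative telescopes to one
    term. *)
Lemma is_derive_taylor_sum (f : nat -> R -> R) n (t : R) :
  (forall k, is_derive (f k) t (f (S k) t)) ->
  is_derive (fun u => sum_f_R0 (fun k => (1 - u) ^ k / INR (fact k) * f k u) n) t
    ((1 - t) ^ n / INR (fact n) * f (S n) t).
Proof.
intros H. induction n as [|n IH].
- simpl. apply (is_derive_ext (f 0%nat)); [intros u; eqR; field|].
  replace (1 / 1 * f 1%nat t) with (f 1%nat t) by field. apply H.
- replace ((1 - t) ^ S n / INR (fact (S n)) * f (S (S n)) t) with
   ((1 - t) ^ n / INR (fact n) * f (S n) t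
     + (- ((1 - t) ^ n / INR (fact n)) * f (S n) t
      + (1 - t) ^ S n / INR (fact (S n)) * f (S (S n)) t)) by ring.
  apply (is_derive_plus (fun u => sum_f_R0 (fun k => (1 - u) ^ k / INR (fact k) * f k u) n)
     (fun u => (1 - u) ^ S n / INR (fact (S n)) * f (S n) u)); [exact IH|].
  apply (is_derive_mult (fun u => (1 - u) ^ S n / INR (fact (S n))) (f (S n)));
    [|apply H|intros; apply Rmult_comm].
  replace (- ((1 - t) ^ n / INR (fact n)))
    with (- INR (S n) * (1 - t) ^ n / INR (fact (S n))).
  2: { rewrite fact_simpl, mult_INR. field.
       split; [apply INR_fact_neq_0|apply not_0_INR; lia]. }
  generalize (INR (fact (S n))); intros F.
  auto_derive; [easy|].
  change (match n with O => 1 | S _ => INR n + 1 end) with (INR (S n)).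
  simpl Nat.pred. unfold Rdiv, Rminus. ring.
Qed.

(** Cauchy's form of the remainder, whose factor (1 - c)^n / n! is at most 1. *)
Lemma taylor_bound (f : nat -> R -> R) n B :
  (forall k t, 0 <= t <= 1 -> is_derive (f k) t (f (S k) t)) ->
  (forall t, 0 <= t <= 1 -> Rabs (f (S n) t) <= B) ->
  Rabs (f 0%nat 1 - sum_f_R0 (fun k => f k 0 / INR (fact k)) n) <= B.
Proof.
intros D HB.
destruct (MVT_gen (fun u => sum_f_R0 (fun k => (1 - u) ^ k / INR (fact k) * f k u) n) 0 1
  (fun t => (1 - t) ^ n / INR (fact n) * f (S n) t)) as [c [Hc E]].
- rewrite Rmin_left, Rmax_right by lra. intros t Ht.
  apply is_derive_taylor_sum. intros k; apply D; lra.
- rewrite Rmin_left, Rmax_right by lra. intros t Ht.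
  apply continuity_pt_filterlim.
  apply (ex_derive_continuous (fun u => sum_f_R0 (fun k => (1 - u) ^ k / INR (fact k) * f k u) n)).
  eexists. apply is_derive_taylor_sum. intros k; apply D; lra.
- rewrite Rmin_left, Rmax_right in Hc by lra.
  replace (f 0%nat 1) with (sum_f_R0 (fun k => (1 - 1) ^ k / INR (fact k) * f k 1) n).
  + rewrite (sum_eq (fun k => f k 0 / INR (fact k))
      (fun k => (1 - 0) ^ k / INR (fact k) * f k 0)).
    * rewrite E, Rminus_0_r, Rmult_1_r, Rabs_mult.
      assert (P : 0 <= (1 - c) ^ n <= 1).
      { split; [apply pow_le; lra|]. rewrite <- (pow1 n) at 2. apply pow_incr; lra. }
      assert (F : 1 <= INR (fact n)) by (apply (le_INR 1), lt_O_fact).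
      rewrite <- (Rmult_1_l B).
      apply Rmult_le_compat; [apply Rabs_pos|apply Rabs_pos| |now apply HB].
      rewrite Rabs_pos_eq by (apply Rdiv_le_0_compat; lra).
      apply Rle_div_l; lra.
    * intros k _. rewrite Rminus_0_r, pow1. field. apply INR_fact_neq_0.
  + clear. induction n as [|n IH]; simpl sum_f_R0.
    * simpl; field.
    * rewrite IH, Rminus_diag. unfold Rdiv; ring.
Qed.

(** The bound 1 <= s0 keeps s away from 0 and makes s^k increasing in k, as [O_pow_le] requires. *)
Definition O_pow (k : nat) (f : R -> R) :=
  exists C s0, 1 <= s0 /\ forall s, s0 <= s -> Rabs (f s) <= C / s ^ k.

Lemma O_pow_const_pos k f : O_pow k f ->
  exists C s0, 0 <= C /\ 1 <= s0 /\ forall s, s0 <= s -> Rabs (f s) <= C / s ^ k.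
Proof.
intros [C [s0 [H0 H]]]. exists C, s0. split; [|easy].
specialize (H s0 (Rle_refl _)).
assert (P : 0 < s0 ^ k) by (apply pow_lt; lra).
assert (A := Rabs_pos (f s0)).
assert (E : 0 <= C / s0 ^ k) by lra.
apply (Rmult_le_compat_r (s0 ^ k)) in E; [|lra].
replace (C / s0 ^ k * s0 ^ k) with C in E by (field; lra). lra.
Qed.

Lemma O_pow_ext k f g s0 : (forall s, s0 <= s -> f s = g s) -> O_pow k f -> O_pow k g.
Proof.
intros E [C [s1 [H1 H]]]. exists C, (Rmax s0 s1).
assert (M1 := Rmax_l s0 s1). assert (M2 := Rmax_r s0 s1).
split; [lra|]. intros s Hs. rewrite <- E by lra. apply H; lra.
Qed.

Lemma O_pow_0 k : O_pow k (fun _ => 0).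
Proof.
exists 0, 1. split; [lra|]. intros s Hs. rewrite Rabs_R0. unfold Rdiv; lra.
Qed.

Lemma O_pow_plus k f g : O_pow k f -> O_pow k g -> O_pow k (fun s => f s + g s).
Proof.
intros [C [s1 [H1 H]]] [C' [s1' [H1' H']]]. exists (C + C'), (Rmax s1 s1').
assert (M1 := Rmax_l s1 s1'). assert (M2 := Rmax_r s1 s1').
split; [lra|]. intros s Hs.
eapply Rle_trans; [apply Rabs_triang|].
rewrite Rdiv_plus_distr. apply Rplus_le_compat; [apply H; lra|apply H'; lra].
Qed.

Lemma O_pow_mult k l f g : O_pow k f -> O_pow l g -> O_pow (k + l) (fun s => f s * g s).
Proof.
intros [C [s1 [H1 H]]] [C' [s1' [H1' H']]]. exists (C * C'), (Rmax s1 s1').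
assert (M1 := Rmax_l s1 s1'). assert (M2 := Rmax_r s1 s1').
split; [lra|]. intros s Hs.
rewrite Rabs_mult, pow_add.
assert (P : 0 < s ^ k) by (apply pow_lt; lra).
assert (P' : 0 < s ^ l) by (apply pow_lt; lra).
replace (C * C' / (s ^ k * s ^ l)) with ((C / s ^ k) * (C' / s ^ l)) by (field; lra).
apply Rmult_le_compat; [apply Rabs_pos|apply Rabs_pos|apply H; lra|apply H'; lra].
Qed.

Lemma O_pow_inv_pow k c : O_pow k (fun s => c / s ^ k).
Proof.
exists (Rabs c), 1. split; [lra|]. intros s Hs.
assert (P : 0 < s ^ k) by (apply pow_lt; lra).
rewrite Rabs_div by lra. rewrite (Rabs_pos_eq (s ^ k)) by lra. lra.
Qed.

Lemma O_pow_scal k c f : O_pow k f -> O_pow k (fun s => c * f s).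
Proof.
intros H. apply (O_pow_mult 0 k (fun _ => c)); [|easy].
apply (O_pow_ext _ (fun s => c / s ^ 0) _ 0); [intros; simpl; field|apply O_pow_inv_pow].
Qed.

Lemma O_pow_minus k f g : O_pow k f -> O_pow k g -> O_pow k (fun s => f s - g s).
Proof.
intros Hf Hg.
apply (O_pow_ext _ (fun s => f s + -1 * g s) _ 0); [intros; ring|].
now apply O_pow_plus; [|apply O_pow_scal].
Qed.

Lemma O_pow_le k l f : (l <= k)%nat -> O_pow k f -> O_pow l f.
Proof.
intros kl H. destruct (O_pow_const_pos _ _ H) as [C [s0 [C0 [H0 HC]]]].
exists C, s0. split; [easy|]. intros s Hs.
eapply Rle_trans; [now apply HC|].
apply Rmult_le_compat_l; [easy|]. apply Rinv_le_contravar; [apply pow_lt; lra|].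
apply Rle_pow; [lra|easy].
Qed.

Lemma O_pow_sum k f n : (forall i, (i <= n)%nat -> O_pow k (f i)) ->
  O_pow k (fun s => sum_f_R0 (fun i => f i s) n).
Proof.
induction n as [|n IH]; intros H; simpl.
- now apply H.
- apply O_pow_plus; [apply IH; intros; apply H; lia|now apply H].
Qed.

Lemma O_pow_shift k f c : 0 <= c -> O_pow k f -> O_pow k (fun s => f (s + c)).
Proof.
intros c0 H. destruct (O_pow_const_pos _ _ H) as [C [s0 [C0 [H0 HC]]]].
exists C, s0. split; [easy|]. intros s Hs.
eapply Rle_trans; [apply HC; lra|].
apply Rmult_le_compat_l; [easy|]. apply Rinv_le_contravar; [apply pow_lt; lra|].
apply pow_incr; lra.
Qed.

(* A solution of [u(s) + u(s + d) = R(s)] vanishing at infinity is the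
   alternating sum of the [R(s + j d)]; comparing with the telescoping sum of
   [1 / s - 1 / (s + d)] loses two powers of [s]. *)
Lemma O_pow_of_shift_sum k d u : 0 < d -> O_pow 1 u ->
  O_pow (k + 2) (fun s => u s + u (s + d)) -> O_pow k u.
Proof.
intros d0 Hu HR.
destruct (O_pow_const_pos _ _ Hu) as [C1 [s1 [C10 [H1 HC1]]]].
destruct (O_pow_const_pos _ _ HR) as [C [s0 [C0 [H0 HC]]]].
exists (C * ((1 + d) / d)), (Rmax s0 s1).
assert (M1 := Rmax_l s0 s1). assert (M2 := Rmax_r s0 s1).
split; [lra|]. intros s Hs.
assert (P : 0 < s ^ k) by (apply pow_lt; lra).
(* The factor (1 + d) / d comes from 1 / t - 1 / (t + d) = d / (t (t + d)) and 1 / t^2 <= (1 + d) /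
   (t (t + d)) for t >= 1. *)
set (D := C * ((1 + d) / d) / s ^ k).
assert (D0 : 0 <= D).
{ unfold D. apply Rdiv_le_0_compat; [|easy]. apply Rmult_le_pos; [easy|].
  apply Rlt_le, Rdiv_lt_0_compat; lra. }
assert (Step : forall t, s <= t -> Rabs (u t) <= D * (/ t - / (t + d)) + Rabs (u (t + d))).
{ intros t Ht.
  assert (B := HC t ltac:(lra)).
  assert (Pt : 0 < t ^ k) by (apply pow_lt; lra).
  assert (E : C / t ^ (k + 2) <= D * (/ t - / (t + d))).
  { unfold D. rewrite pow_add.
    apply Rle_trans with (C / s ^ k * / t ^ 2).
    - replace (C / (t ^ k * t ^ 2)) with (C / t ^ k * / t ^ 2) by (field; lra).
      apply Rmult_le_compat_r; [apply Rlt_le, Rinv_0_lt_compat, pow_lt; lra|].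
      apply Rmult_le_compat_l; [easy|]. apply Rinv_le_contravar; [easy|].
      apply pow_incr; lra.
    - replace (C * ((1 + d) / d) / s ^ k * (/ t - / (t + d)))
        with (C / s ^ k * ((1 + d) / (t * (t + d)))) by (field; lra).
      apply Rmult_le_compat_l; [apply Rdiv_le_0_compat; lra|].
      apply (Rmult_le_reg_r (t ^ 2 * (t + d))); [apply Rmult_lt_0_compat; [apply pow_lt|]; lra|].
      field_simplify; [nra|lra|lra]. }
  replace (u t) with (u t + u (t + d) + - u (t + d)) by ring.
  eapply Rle_trans; [apply Rabs_triang|]. rewrite Rabs_Ropp. lra. }
assert (Iter : forall n, Rabs (u s) <= D * (/ s - / (s + INR n * d)) + Rabs (u (s + INR n * d))).
{ induction n as [|n IH].
  - simpl. rewrite Rmult_0_l, Rplus_0_r. lra.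
  - assert (In := pos_INR n). assert (Q : 0 <= INR n * d) by (apply Rmult_le_pos; lra).
    assert (St := Step (s + INR n * d) ltac:(lra)).
    rewrite S_INR. replace (s + (INR n + 1) * d) with (s + INR n * d + d) by ring.
    lra. }
apply le_epsilon. intros eps eps0.
(* After n + 1 shifts the argument exceeds C1 / eps, so the leftover value of u is at most eps. *)
destruct (nfloor_ex (C1 / eps / d)) as [n Hn].
{ apply Rdiv_le_0_compat; [|easy]. now apply Rdiv_le_0_compat. }
specialize (Iter (S n)). rewrite S_INR in Iter.
set (t := s + (INR n + 1) * d) in *.
assert (Ht : C1 / eps <= (INR n + 1) * d).
{ replace (C1 / eps) with (C1 / eps / d * d) by (field; lra).
  apply Rmult_le_compat_r; lra. }
assert (Q : 0 <= (INR n + 1) * d).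
{ eapply Rle_trans; [|exact Ht]. now apply Rdiv_le_0_compat. }
assert (B := HC1 t ltac:(unfold t; lra)). rewrite pow_1 in B.
assert (E1 : C1 / t <= eps).
{ apply Rle_div_l; [unfold t; lra|].
  apply Rle_trans with (eps * (C1 / eps)); [right; field; lra|].
  apply Rmult_le_compat_l; unfold t; lra. }
assert (T0 : 0 < / t) by (apply Rinv_0_lt_compat; unfold t; lra).
assert (S1 : / s <= 1) by (rewrite <- Rinv_1; apply Rinv_le_contravar; lra).
assert (D * (/ s - / t) <= D * 1) by (apply Rmult_le_compat_l; lra).
lra.
Qed.

Definition ln_deriv (n : nat) (s : R) :=
  match n with
  | O => ln s
  | S k => (-1) ^ k * INR (fact k) / s ^ S k
  end.

Lemma is_derive_ln_deriv n s : 0 < s -> is_derive (ln_deriv n) s (ln_deriv (S n) s).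
Proof.
intros hs. destruct n as [|k]; unfold ln_deriv.
- auto_derive; [easy|]. simpl. field. lra.
- assert (P : 0 < s ^ k) by (apply pow_lt; lra).
  auto_derive.
  + apply Rgt_not_eq, (pow_lt _ (S k)); lra.
  + change (match k with O => 1 | S _ => INR k + 1 end) with (INR (S k)).
    rewrite fact_simpl, mult_INR. simpl. field. lra.
Qed.

Lemma ln_deriv_taylor n h M :
  O_pow (n + M + 1) (fun s => ln_deriv n (s + h)
    - sum_f_R0 (fun j => h ^ j / INR (fact j) * ln_deriv (n + j) s) M).
Proof.
(* For s beyond 2 |h| the whole segment from s to s + h stays above s / 2; this costs the power of
   2. *)
exists (Rabs h ^ S M * (INR (fact (n + M)) * 2 ^ (n + M + 1))), (2 * Rabs h + 1).
assert (A0 := Rabs_pos h). split; [lra|]. intros s Hs.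
assert (Hp : forall t, 0 <= t <= 1 -> s / 2 <= s + t * h).
{ intros t Ht. assert (- Rabs h <= t * h); [|lra].
  assert (E : Rabs (t * h) <= Rabs h).
  { rewrite Rabs_mult, (Rabs_pos_eq t) by lra. nra. }
  apply Rabs_le_between in E. lra. }
assert (B := taylor_bound (fun k t => h ^ k * ln_deriv (n + k) (s + t * h)) M
   (Rabs h ^ S M * (INR (fact (n + M)) * 2 ^ (n + M + 1)) / s ^ (n + M + 1))).
match type of B with ?H1 -> ?H2 -> ?c =>
  assert (B1 : H1); [|assert (B2 : H2); [|specialize (B B1 B2)]] end.
- intros k t Ht. specialize (Hp t Ht).
  assert (D := is_derive_ln_deriv (n + k) (s + t * h) ltac:(lra)).
  replace (h ^ S k * ln_deriv (n + S k) (s + t * h))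
    with (scal (h ^ k) (scal h (ln_deriv (S (n + k)) (s + t * h)))).
  2: { rewrite Nat.add_succ_r. unfold scal; simpl; unfold mult; simpl. ring. }
  apply (is_derive_scal (fun t => ln_deriv (n + k) (s + t * h))).
  apply (is_derive_comp (ln_deriv (n + k)) (fun t => s + t * h)); [exact D|].
  auto_derive; [easy|ring].
- intros t Ht. specialize (Hp t Ht).
  rewrite Nat.add_succ_r, Rabs_mult, RPow_abs. unfold ln_deriv.
  replace (n + M + 1)%nat with (S (n + M)) by lia.
  set (m := (n + M)%nat).
  assert (P : 0 < (s + t * h) ^ S m) by (apply pow_lt; lra).
  assert (P' : 0 < s ^ S m) by (apply pow_lt; lra).
  rewrite Rabs_div by lra. rewrite Rabs_mult, pow_1_abs, Rmult_1_l.
  rewrite (Rabs_pos_eq (INR _)) by apply pos_INR.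
  rewrite (Rabs_pos_eq (_ ^ S m)) by lra.
  unfold Rdiv. rewrite Rmult_assoc. apply Rmult_le_compat_l; [apply Rabs_pos|].
  rewrite Rmult_assoc. apply Rmult_le_compat_l; [apply pos_INR|].
  apply (Rmult_le_reg_r ((s + t * h) ^ S m)); [easy|].
  rewrite Rinv_l by lra.
  apply (Rmult_le_reg_r (s ^ S m)); [easy|].
  replace (2 ^ S m * / s ^ S m * (s + t * h) ^ S m * s ^ S m)
    with ((2 * (s + t * h)) ^ S m) by (rewrite Rpow_mult_distr; field; lra).
  rewrite Rmult_1_l. apply pow_incr. lra.
- simpl in B. rewrite Nat.add_0_r, !Rmult_1_l in B.
  eapply Rle_trans; [|exact B]. right. f_equal. f_equal.
  apply sum_eq. intros j Hj. rewrite Rmult_0_l, Rplus_0_r. unfold Rdiv. ring.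
Qed.

(** Odd powers of h cancel and even ones double, leaving the truncation of 2 cosh(h D). *)
Lemma ln_deriv_taylor_sym n h M :
  O_pow (n + M + 1) (fun s => ln_deriv n (s + h) + ln_deriv n (s - h)
    - 2 * sum_f_R0 (fun j => cosh_coef h j * ln_deriv (n + j) s) M).
Proof.
assert (H := O_pow_plus _ _ _ (ln_deriv_taylor n h M) (ln_deriv_taylor n (- h) M)).
revert H. apply O_pow_ext with (s0 := 0). intros s _.
assert (E : 2 * sum_f_R0 (fun j => cosh_coef h j * ln_deriv (n + j) s) M
  = sum_f_R0 (fun j => h ^ j / INR (fact j) * ln_deriv (n + j) s) M
   + sum_f_R0 (fun j => (- h) ^ j / INR (fact j) * ln_deriv (n + j) s) M).
{ rewrite <- sum_plus, scal_sum. apply sum_eq. intros j _. unfold cosh_coef.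
  replace ((- h) ^ j) with ((-1) ^ j * h ^ j) by (rewrite <- Rpow_mult_distr; f_equal; ring).
  destruct (Nat.even j) eqn:Ej.
  - apply Nat.even_spec in Ej. destruct Ej as [i ->]. rewrite pow_1_even. unfold Rdiv; ring.
  - rewrite <- Nat.negb_odd in Ej. apply Bool.negb_false_iff, Nat.odd_spec in Ej.
    destruct Ej as [i ->]. rewrite Nat.add_1_r, pow_1_odd. unfold Rdiv; ring. }
rewrite E. unfold Rminus. ring.
Qed.

(** * Asymptotic expansions *)

(** At a fixed N this is stronger than Poincare's o(1 / s^N). *)
Definition expansion (N : nat) (f : R -> R) (c : nat -> R) :=
  O_pow (S N) (fun s => f s - sum_f_R0 (fun m => c m / s ^ m) N).

Lemma expansion_le M N f c : (M <= N)%nat -> expansion N f c -> expansion M f c.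
Proof.
induction 1 as [|N MN IH]; [easy|]. intros H. apply IH.
unfold expansion in *. apply (O_pow_le _ (S N)) in H; [|lia].
apply (O_pow_ext _ (fun s => f s - sum_f_R0 (fun m => c m / s ^ m) (S N) + c (S N) / s ^ S N) _ 0).
- intros s _. rewrite tech5. ring.
- apply O_pow_plus; [easy|apply O_pow_inv_pow].
Qed.

Lemma expansion_O_pow_0 N f c : expansion N f c -> O_pow 0 f.
Proof.
intros H. apply (expansion_le 0) in H; [|lia].
apply (O_pow_le _ 0) in H; [|lia].
apply (O_pow_ext _ (fun s => f s - sum_f_R0 (fun m => c m / s ^ m) 0 + c 0%nat / s ^ 0) _ 0).
- intros s _. simpl. ring.
- apply O_pow_plus; [easy|apply O_pow_inv_pow].
Qed.

Lemma expansion_ext_coef N f c d :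
  (forall m, (m <= N)%nat -> c m = d m) -> expansion N f c -> expansion N f d.
Proof.
intros E. apply O_pow_ext with (s0 := 0). intros s _. f_equal. apply sum_eq.
intros m Hm. now rewrite E.
Qed.

Lemma expansion_mul N f g c d :
  expansion N f c -> expansion N g d -> expansion N (fun s => f s * g s) (fps_mul c d).
Proof.
intros Hf Hg. unfold expansion.
(* Truncating g at order N - i against c_i / s^i makes every error of order N + 1 and leaves exactly
   the Cauchy product up to N. *)
apply (O_pow_ext _ (fun s => (f s - sum_f_R0 (fun m => c m / s ^ m) N) * g s
  + sum_f_R0 (fun i => c i / s ^ i * (g s - sum_f_R0 (fun j => d j / s ^ j) (N - i))) N) _ 1).
- intros s Hs.
  assert (E : sum_f_R0 (fun m => fps_mul c d m / s ^ m) N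
    = sum_f_R0 (fun i => c i / s ^ i * sum_f_R0 (fun j => d j / s ^ j) (N - i)) N).
  { symmetry.
    rewrite (sum_eq _ (fun i => sum_f_R0 (fun j => c i / s ^ i * (d j / s ^ j)) (N - i))).
    - rewrite (sum_triangle (fun i j => c i / s ^ i * (d j / s ^ j))).
      apply sum_eq. intros m _. unfold fps_mul, Rdiv at 3.
      rewrite (Rmult_comm _ (/ s ^ m)), scal_sum. apply sum_eq. intros i Hi.
      replace (s ^ m) with (s ^ i * s ^ (m - i)) by (rewrite <- pow_add; f_equal; lia).
      field. split; apply pow_nonzero; lra.
    - intros i _. rewrite scal_sum. apply sum_eq. intros; ring. }
  rewrite E.
  rewrite (sum_eq (fun i => c i / s ^ i * (g s - sum_f_R0 (fun j => d j / s ^ j) (N - i)))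
    (fun i => c i / s ^ i * g s - c i / s ^ i * sum_f_R0 (fun j => d j / s ^ j) (N - i)))
    by (intros; ring).
  rewrite minus_sum, <- scal_sum. ring.
- apply O_pow_plus.
  + rewrite <- (Nat.add_0_r (S N)). apply O_pow_mult; [easy|].
    now apply expansion_O_pow_0 with N d.
  + apply (O_pow_sum _ (fun i s => c i / s ^ i * (g s - sum_f_R0 (fun j => d j / s ^ j) (N - i)))).
    intros i Hi. replace (S N) with (i + S (N - i))%nat by lia.
    apply O_pow_mult; [apply O_pow_inv_pow|].
    apply (expansion_le _ N); [lia|easy].
Qed.

Lemma expansion_pow N f c j :
  expansion N f c -> expansion N (fun s => f s ^ j) (fps_pow c j).
Proof.
intros H. induction j as [|j IH].
- apply (O_pow_ext _ (fun _ => 0) _ 0); [|apply O_pow_0].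
  intros s _. clear. induction N as [|N IH]; [simpl; field|].
  rewrite tech5. simpl fps_pow at 2. unfold Rdiv at 2. rewrite Rmult_0_l, Rplus_0_r. exact IH.
- now apply expansion_mul.
Qed.

Lemma fps_pow_small c j : c 0%nat = 0 -> forall m, (m < j)%nat -> fps_pow c j m = 0.
Proof.
intros c0. induction j as [|j IH]; intros m Hm; [lia|].
simpl. unfold fps_mul. rewrite (sum_eq _ (fun _ => 0)).
- rewrite sum_cte. ring.
- intros i Hi. destruct i as [|i]; [rewrite c0; ring|].
  rewrite IH; [ring|lia].
Qed.

Lemma expansion_O_pow_1 N f c : c 0%nat = 0 -> expansion N f c -> O_pow 1 f.
Proof.
intros c0 H. apply (expansion_le 0) in H; [|lia].
revert H. apply O_pow_ext with (s0 := 0). intros s _. simpl. rewrite c0. field.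
Qed.

Lemma exp_taylor_bound x n : Rabs x <= 1 ->
  Rabs (exp x - sum_f_R0 (fun j => x ^ j / INR (fact j)) n) <= exp 1 * Rabs x ^ S n.
Proof.
intros Hx.
assert (B := taylor_bound (fun k t => x ^ k * exp (t * x)) n (exp 1 * Rabs x ^ S n)).
match type of B with ?H1 -> ?H2 -> ?c =>
  assert (B1 : H1); [|assert (B2 : H2); [|specialize (B B1 B2)]] end.
- intros k t _. auto_derive; [easy|]. simpl; ring.
- intros t Ht. rewrite Rabs_mult, RPow_abs, Rmult_comm.
  apply Rmult_le_compat_r; [apply Rabs_pos|].
  rewrite Rabs_pos_eq by apply Rlt_le, exp_pos.
  apply Rcomplements.Rabs_le_between in Hx.
  assert (t * x <= 1) by nra.
  destruct (Req_dec (t * x) 1) as [->|E]; [lra|]. apply Rlt_le, exp_increasing; lra.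
- simpl in B. rewrite !Rmult_1_l in B. eapply Rle_trans; [|exact B].
  right. f_equal. f_equal. apply sum_eq. intros j _. rewrite Rmult_0_l, exp_0. unfold Rdiv; ring.
Qed.

Lemma O_pow_exp_remainder f n : O_pow 1 f ->
  O_pow (S n) (fun s => exp (f s) - sum_f_R0 (fun j => f s ^ j / INR (fact j)) n).
Proof.
intros H. destruct (O_pow_const_pos _ _ H) as [C [s0 [C0 [H0 HC]]]].
(* From s >= C on, |f s| <= C / s <= 1, as [exp_taylor_bound] requires. *)
exists (exp 1 * C ^ S n), (Rmax s0 C).
assert (M1 := Rmax_l s0 C). assert (M2 := Rmax_r s0 C).
split; [lra|]. intros s Hs.
assert (B := HC s ltac:(lra)). rewrite pow_1 in B.
eapply Rle_trans; [apply exp_taylor_bound|].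
- eapply Rle_trans; [exact B|]. apply Rle_div_l; lra.
- unfold Rdiv. rewrite Rmult_assoc. apply Rmult_le_compat_l; [apply Rlt_le, exp_pos|].
  rewrite <- pow_inv, <- Rpow_mult_distr.
  apply pow_incr. split; [apply Rabs_pos|exact B].
Qed.

Lemma expansion_exp N f c : c 0%nat = 0 ->
  expansion N f c -> expansion N (fun s => exp (f s)) (fps_exp_coef c).
Proof.
intros c0 H.
(* The sum over j <= m may run up to N for every m, since c^j has no terms below degree j; the two
   summations can then be exchanged. *)
apply (expansion_ext_coef _ _ (fun m => sum_f_R0 (fun j => fps_pow c j m / INR (fact j)) N)).
- intros m Hm. unfold fps_exp_coef.
  destruct (Nat.eq_dec m N) as [->|Ne]; [easy|].
  rewrite (tech2 _ m N) by lia.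
  rewrite (sum_eq (fun i => fps_pow c (S m + i) m / INR (fact (S m + i))) (fun _ => 0)).
  + rewrite sum_cte. ring.
  + intros i _. rewrite fps_pow_small; [unfold Rdiv; ring|easy|lia].
- unfold expansion.
  apply (O_pow_ext _ (fun s => (exp (f s) - sum_f_R0 (fun j => f s ^ j / INR (fact j)) N)
    + sum_f_R0 (fun j => / INR (fact j)
        * (f s ^ j - sum_f_R0 (fun m => fps_pow c j m / s ^ m) N)) N) _ 0).
  + intros s _.
    assert (E : sum_f_R0 (fun m => sum_f_R0 (fun j => fps_pow c j m / INR (fact j)) N / s ^ m) N
      = sum_f_R0 (fun j => / INR (fact j) * sum_f_R0 (fun m => fps_pow c j m / s ^ m) N) N).
    { symmetry.
      rewrite (sum_eq _ (fun j => sum_f_R0 (fun m => fps_pow c j m / INR (fact j) / s ^ m) N)).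
      - rewrite sum_exchange. apply sum_eq. intros m _.
        unfold Rdiv at 3. rewrite (Rmult_comm _ (/ s ^ m)), scal_sum. now apply sum_eq.
      - intros j _. rewrite scal_sum. apply sum_eq. intros m _. unfold Rdiv; ring. }
    rewrite E.
    rewrite (sum_eq (fun j => / INR (fact j)
        * (f s ^ j - sum_f_R0 (fun m => fps_pow c j m / s ^ m) N))
      (fun j => f s ^ j / INR (fact j)
        - / INR (fact j) * sum_f_R0 (fun m => fps_pow c j m / s ^ m) N))
      by (intros; unfold Rdiv; ring).
    rewrite minus_sum. ring.
  + apply O_pow_plus.
    * now apply O_pow_exp_remainder, expansion_O_pow_1 with N c.
    * apply (O_pow_sum _ (fun j s => / INR (fact j)
        * (f s ^ j - sum_f_R0 (fun m => fps_pow c j m / s ^ m) N))).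
      intros j _. now apply O_pow_scal, expansion_pow.
Qed.

(* Coefficients of [cosh (alpha D) / cosh (r D)], the operator that maps
   [ln s] to [ln (y s)] by the functional equation. *)
Definition log_y_coef (r : R) := fps_mul (cosh_coef (r - 1)) (sech_coef r).

Lemma log_y_coef_cosh r m : fps_mul (log_y_coef r) (cosh_coef r) m = cosh_coef (r - 1) m.
Proof.
unfold log_y_coef. rewrite fps_mul_assoc, <- (fps_mul_1_r (cosh_coef (r - 1)) m).
apply fps_mul_ext; [easy|]. intros i _. now rewrite sech_cosh_coef.
Qed.

Lemma log_y_coef_0 r : log_y_coef r 0 = 1.
Proof.
unfold log_y_coef, fps_mul, cosh_coef, sech_coef, euler_num; simpl. rewrite cosh_0. field.
Qed.

Lemma log_y_coef_odd r m : Nat.odd m = true -> log_y_coef r m = 0.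
Proof.
intros Hm. unfold log_y_coef, fps_mul. rewrite (sum_eq _ (fun _ => 0)).
- rewrite sum_cte; ring.
- intros i Hi. unfold cosh_coef, sech_coef. destruct (Nat.even i) eqn:Ei; [|ring].
  rewrite euler_num_odd; [unfold Rdiv; ring|].
  rewrite Nat.odd_sub, Hm by easy. now rewrite <- Nat.negb_even, Ei.
Qed.

Lemma log_y_coef_even r n : log_y_coef r (2 * n) =
  sum_f_R0 (fun k => Binomial.C (2 * n) (2 * k) * (r - 1) ^ (2 * k)
                         * r ^ (2 * (n - k)) * euler_num (2 * (n - k))) n / INR (fact (2 * n)).
Proof.
unfold log_y_coef, fps_mul. rewrite sum_even.
- unfold Rdiv at 1. rewrite Rmult_comm, scal_sum. apply sum_eq. intros k Hk.
  unfold cosh_coef, sech_coef, Binomial.C.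
  replace (Nat.even (2 * k)) with true
    by (symmetry; apply Nat.even_spec; now exists k).
  replace (2 * n - 2 * k)%nat with (2 * (n - k))%nat by lia.
  field. repeat split; apply INR_fact_neq_0.
- intros k Hk. unfold cosh_coef. rewrite <- Nat.negb_odd, Hk. simpl. ring.
Qed.

(** The derivative of ln of order 2 n is -(2 n - 1)! / s^(2 n); against the (2 n)! of the Taylor
    coefficient it leaves the factor -1 / (2 n). *)
Lemma F_coef_ln_deriv r m s : s <> 0 ->
  log_y_coef r (S m) * ln_deriv (S m) s = F_coef r (S m) / s ^ S m.
Proof.
intros hs. unfold F_coef. destruct (Nat.even (S m)) eqn:Em.
- apply Nat.even_spec in Em. destruct Em as [n En].
  replace (Nat.div2 (S m)) with n by (now rewrite En, Nat.div2_double).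
  replace (log_y_coef r (S m)) with (log_y_coef r (2 * n)) by now rewrite En.
  rewrite log_y_coef_even.
  destruct n as [|n]; [lia|].
  set (S0 := sum_f_R0 _ _).
  unfold ln_deriv.
  replace ((-1) ^ m) with (-1).
  2: { replace m with (S (2 * n)) by lia. now rewrite pow_1_odd. }
  rewrite <- En, fact_simpl, mult_INR.
  replace (2 * INR (S n)) with (INR (S m)).
  2: { rewrite En, mult_INR. simpl INR. ring. }
  field. repeat split; try (apply pow_nonzero; easy); try apply INR_fact_neq_0; apply not_0_INR; lia.
- rewrite log_y_coef_odd; [unfold Rdiv; ring|]. now rewrite <- Nat.negb_even, Em.
Qed.

Definition log_y_approx r N s := sum_f_R0 (fun n => log_y_coef r n * ln_deriv n s) N.

Lemma log_y_approx_F r N s : s <> 0 ->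
  log_y_approx r N s = ln s + sum_f_R0 (fun m => F_coef r m / s ^ m) N.
Proof.
intros hs. unfold log_y_approx. induction N as [|N IH].
- simpl. rewrite log_y_coef_0. unfold F_coef; simpl. field.
- rewrite !tech5, IH, F_coef_ln_deriv by easy. ring.
Qed.

(** The n-th term is expanded only up to N - n, so that all remainders have order N + 1. The double
    sum is then a Cauchy product with cosh(r D), which cancels the denominator of [log_y_coef]. *)
Lemma log_y_approx_sym r N :
  O_pow (S N) (fun s => log_y_approx r N (s + r) + log_y_approx r N (s - r)
    - 2 * sum_f_R0 (fun m => cosh_coef (r - 1) m * ln_deriv m s) N).
Proof.
apply (O_pow_ext _ (fun s => sum_f_R0 (fun n => log_y_coef r n *
   (ln_deriv n (s + r) + ln_deriv n (s - r)
    - 2 * sum_f_R0 (fun j => cosh_coef r j * ln_deriv (n + j) s) (N - n))) N) _ 0).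
- intros s _. unfold log_y_approx.
  rewrite (sum_eq _ (fun n => log_y_coef r n * ln_deriv n (s + r)
     + log_y_coef r n * ln_deriv n (s - r)
     - sum_f_R0 (fun j => log_y_coef r n * cosh_coef r j * ln_deriv (n + j) s) (N - n) * 2)).
  + rewrite minus_sum, sum_plus, <- scal_sum. f_equal. f_equal.
    rewrite (sum_triangle (fun n j => log_y_coef r n * cosh_coef r j * ln_deriv (n + j) s)).
    apply sum_eq. intros m _. rewrite <- log_y_coef_cosh. unfold fps_mul.
    rewrite Rmult_comm, scal_sum. apply sum_eq. intros i Hi.
    now replace (i + (m - i))%nat with m by lia.
  + intros n _.
    rewrite (sum_eq (fun j => log_y_coef r n * cosh_coef r j * ln_deriv (n + j) s)
      (fun j => cosh_coef r j * ln_deriv (n + j) s * log_y_coef r n)) by (intros; ring).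
    rewrite <- scal_sum. ring.
- apply (O_pow_sum _ (fun n s => log_y_coef r n *
   (ln_deriv n (s + r) + ln_deriv n (s - r)
    - 2 * sum_f_R0 (fun j => cosh_coef r j * ln_deriv (n + j) s) (N - n)))).
  intros n Hn. apply O_pow_scal.
  replace (S N) with (n + (N - n) + 1)%nat by lia. apply ln_deriv_taylor_sym.
Qed.

(** * The expansion of ln y *)

Section Asymptotics.
Variable r : R.
Hypothesis hr : 1 / 2 < r.

Lemma y_fun_pos s : 0 < s -> 0 < y_fun r s.
Proof. intros hs. assert (H := y_fun_bounds r hr s hs). lra. Qed.

Lemma ln_y_fun_sum s : 0 < s ->
  ln (y_fun r s) + ln (y_fun r (s + 2 * r))
  = ln_deriv 0 (s + r + (r - 1)) + ln_deriv 0 (s + r - (r - 1)).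
Proof.
intros hs. simpl ln_deriv.
rewrite <- !ln_mult by (try apply y_fun_pos; lra).
rewrite y_fun_functional_equation by lra. f_equal. ring.
Qed.

Lemma ln_y_fun_ratio_O : O_pow 1 (fun s => ln (y_fun r s) - ln s).
Proof.
exists (a_coef r 1 / 2), 1. split; [lra|]. intros s Hs.
assert (H := y_fun_bounds r hr s ltac:(lra)).
assert (A := a_coef_pos r 1 hr).
rewrite <- ln_div by lra.
assert (E : 1 <= y_fun r s / s <= 1 + a_coef r 1 / 2 / s).
{ split; [apply Rle_div_r; lra|]. apply Rle_div_l; [lra|].
  apply Rle_trans with (s + a_coef r 1 / (2 * s)); [lra|].
  replace ((1 + a_coef r 1 / 2 / s) * s) with (s + a_coef r 1 / 2) by (field; lra).
  apply Rplus_le_compat_l, Rmult_le_compat_l; [lra|]. apply Rinv_le_contravar; lra. }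
rewrite pow_1, Rabs_pos_eq.
- assert (Hl := ln_le (y_fun r s / s) (exp (a_coef r 1 / 2 / s)) ltac:(lra)).
  rewrite ln_exp in Hl. apply Hl.
  assert (X := exp_ineq1_le (a_coef r 1 / 2 / s)). lra.
- rewrite <- ln_1. apply ln_le; lra.
Qed.

Lemma ln_y_fun_expansion N :
  expansion N (fun s => ln (y_fun r s) - ln s) (F_coef r).
Proof.
(* Two extra terms compensate for the two powers lost in [O_pow_of_shift_sum]. *)
set (u := fun s => ln (y_fun r s) - log_y_approx r (N + 2) s).
assert (U1 : O_pow 1 u).
{ apply (O_pow_ext _ (fun s => (ln (y_fun r s) - ln s)
     - sum_f_R0 (fun m => F_coef r m / s ^ m) (N + 2)) _ 1).
  - intros s Hs. unfold u. rewrite log_y_approx_F by lra. ring.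
  - apply O_pow_minus; [exact ln_y_fun_ratio_O|].
    apply (O_pow_sum _ (fun m s => F_coef r m / s ^ m)).
    intros [|m] _.
    + apply (O_pow_ext _ (fun _ => 0) _ 0); [|apply O_pow_0].
      intros s _. unfold F_coef; simpl. field.
    + apply (O_pow_le (S m)); [lia|]. apply O_pow_inv_pow. }
assert (UN : O_pow (S N) u).
{ apply (O_pow_of_shift_sum _ (2 * r)); [lra|exact U1|].
  replace (S N + 2)%nat with (S (N + 2)) by lia.
  assert (T := ln_deriv_taylor_sym 0 (r - 1) (N + 2)).
  replace (0 + (N + 2) + 1)%nat with (S (N + 2)) in T by lia.
  assert (H := O_pow_minus _ _ _ T (log_y_approx_sym r (N + 2))).
  (* Both symmetric estimates are centred at s and their cosh((r - 1) D) sums cancel; the shift by r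
     moves the arguments s - r and s + r to s and s + 2 r. *)
  apply (O_pow_shift _ _ r) in H; [|lra].
  revert H. apply O_pow_ext with (s0 := 1). intros s Hs. cbv beta. unfold u.
  replace (s + r + r) with (s + 2 * r) by ring.
  replace (s + r - r) with s by ring.
  assert (E := ln_y_fun_sum s ltac:(lra)).
  simpl Nat.add. lra. }
unfold expansion.
(* The two extra terms are themselves within the error of order N + 1. *)
apply (O_pow_ext _ (fun s => u s + (F_coef r (S N) / s ^ S N + F_coef r (S (S N)) / s ^ S (S N))) _ 1).
- intros s Hs. unfold u. rewrite log_y_approx_F by lra.
  replace (N + 2)%nat with (S (S N)) by lia. rewrite !tech5. ring.
- apply O_pow_plus; [exact UN|]. apply O_pow_plus; [apply O_pow_inv_pow|].
  apply (O_pow_le (S (S N))); [lia|]. apply O_pow_inv_pow.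
Qed.

End Asymptotics.

Theorem theorem10 (r : R) (hr : 1 / 2 < r) :
  (* the continued fraction defining y(s,r) converges for every s > 0 *)
  (forall s : R, 0 < s -> ex_finite_lim_seq (cf_conv (a_coef r) (b_coef s))) /\
  (* Poincare asymptotic expansion y(s,r)/s ~ sum_m d_m s^(-m), d = exp(F) *)
  (forall N : nat,
     is_lim
       (fun s => s ^ N *
          (y_fun r s / s
           - sum_f_R0 (fun m => fps_exp_coef (F_coef r) m / s ^ m) N))
       p_infty 0).
Proof.
split; [now apply cf_conv_a_coef_converges|].
intros N.
(* Since exp(ln y - ln s) = y / s, the remainder times s^N is at most C / s. *)
destruct (expansion_exp N _ _ eq_refl (ln_y_fun_expansion r hr N)) as [C [s0 [H0 HC]]].
assert (L : is_lim (fun s => C * / s) p_infty 0).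
{ replace (Finite 0) with (Rbar_mult C 0) by (simpl; now rewrite Rmult_0_r).
  apply is_lim_scal_l. apply (is_lim_inv _ _ p_infty); [apply is_lim_id|easy]. }
apply (is_lim_le_le_loc (fun s => - (C * / s)) (fun s => C * / s)).
- exists s0. intros s Hs. apply Rabs_le_between.
  assert (Y := y_fun_pos r hr s ltac:(lra)).
  specialize (HC s ltac:(lra)).
  unfold Rminus in HC at 2. rewrite exp_plus, exp_Ropp, !exp_ln in HC by lra.
  assert (P : 0 < s ^ N) by (apply pow_lt; lra).
  rewrite Rabs_mult, (Rabs_pos_eq (s ^ N)) by lra.
  replace (C * / s) with (s ^ N * (C / s ^ S N)) by (simpl; field; lra).
  apply Rmult_le_compat_l; [lra|exact HC].
- replace (Finite 0) with (Rbar_opp 0) by (simpl; now rewrite Ropp_0).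
  now apply is_lim_opp.
- exact L.
Qed.
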